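(* Let $\ell\in\mathbb{N}$ be fixed. There is a constant $C>0$ depending only on $\ell$ such that the following holds for all $d,r,N\in\mathbb{N}$ with $N\ge C\,dr$ and every log-concave distribution $\mathcal{D}$ on $\mathbb{R}$ with a density. Let $S_r$ be the set of all functions $f:\mathbb{R}^d\to\mathbb{R}$ for which there exist $a_1,\dots,a_r\in\mathbb{R}$ and $W_1,\dots,W_r\in\mathbb{R}^d$ with $f(x)=\sum_{j\le r}a_j\langle W_j,x\rangle^\ell$ for all $x\in\mathbb{R}^d$ (two-layer neural networks of width at most $r$ with activation $\sigma(t)=t^\ell$). Let $\boldsymbol{X}_1,\dots,\boldsymbol{X}_N\sim\mathcal{D}^{\otimes d}$ be i.i.d. random vectors. Then $$\mathbb{P}\Bigl[\forall \boldsymbol{f}^*\in S_r:\ \bigl\{f\in S_r: f(\boldsymbol{X}_i)=\boldsymbol{f}^*(\boldsymbol{X}_i)\ \ \forall i\in\{1,\dots,N\}\bigr\}=\{\boldsymbol{f}^*\}\Bigr]=1 .$$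
   Context: A distribution on $\mathbb{R}$ with density $f$ is log-concave if $-\log f$ is a convex function (with values in $(-\infty,+\infty]$). $\mathcal{D}^{\otimes d}$ is the $d$-fold product measure, i.e. the entries of $\boldsymbol{X}_i$ are i.i.d. samples from $\mathcal{D}$. Elements of $S_r$ are regarded as functions, so equality means equality as functions on $\mathbb{R}^d$. *)

(* Defs.v *)
From HB Require Import structures.
From mathcomp Require Import all_boot all_order all_algebra.
From mathcomp Require Import all_classical all_reals all_analysis.

Set Implicit Arguments.
Unset Strict Implicit.
Unset Printing Implicit Defensive.

Import Order.TTheory GRing.Theory Num.Theory.
Import numFieldNormedType.Exports.

Local Open Scope classical_set_scope.
Local Open Scope ring_scope.

(* The point space R^d is [d.-tuple R], which carries the product
   sigma-algebra of the Borel sigma-algebra of [R]. *)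
Definition dotp (R : realType) (d : nat) (w x : d.-tuple R) : R :=
  \sum_(k < d) tnth w k * tnth x k.

Definition network (R : realType) (l d r : nat) : set (d.-tuple R -> R) :=
  [set f | exists (a : 'I_r -> R) (W : 'I_r -> d.-tuple R),
     forall x, f x = \sum_(j < r) a j * dotp (W j) x ^+ l].

(* Convexity for functions with values in ]-oo, +oo]. *)
Definition convex_ereal (R : realType) (g : R -> \bar R) : Prop :=
  (forall x, g x != -oo%E) /\
  forall (x y t : R), 0 <= t <= 1 ->
    (g (t * x + (1 - t) * y)%R <= t%:E * g x + (1 - t)%:E * g y)%E.

Definition has_density (R : realType) (D : probability (measurableTypeR R) R)
    (f : R -> R) : Prop :=
  [/\ forall x, 0 <= f x,
      measurable_fun [set: measurableTypeR R] f &
      forall A : set (measurableTypeR R), measurable A ->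
        D A = (\int[lebesgue_measure]_(x in A) (f x)%:E)%E].

(* [lne 0 = -oo], so [- lne (f x)] is [+oo] where the density vanishes. *)
Definition log_concave (R : realType) (D : probability (measurableTypeR R) R) :
    Prop :=
  exists f : R -> R,
    has_density D f /\ convex_ereal (fun x => (- lne (f x)%:E)%E).

(* [mu] is the [d]-fold product measure of [D]; the value on measurable boxes
   determines a probability measure on [d.-tuple R]. *)
Definition is_power_measure (R : realType) (d : nat)
    (D : probability (measurableTypeR R) R)
    (mu : probability (d.-tuple (measurableTypeR R)) R) : Prop :=
  forall B : 'I_d -> set (measurableTypeR R), (forall k, measurable (B k)) ->
    mu [set x | forall k, B k (tnth x k)] = (\prod_(k < d) D (B k))%E.

Definition mutually_independent (R : realType) (dO dT : measure_display)
    (Omega : measurableType dO) (T : measurableType dT) (P : probability Omega R)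
    (N : nat) (X : 'I_N -> {RV P >-> T}) : Prop :=
  forall (J : {set 'I_N}) (A : 'I_N -> set T), (forall i, measurable (A i)) ->
    P [set w | forall i, i \in J -> A i (X i w)] =
    (\prod_(i in J) P (X i @^-1` A i))%E.

(* Main.v *)
Require Import Defs.
From HB Require Import structures.
From mathcomp Require Import all_boot all_order all_algebra.
From mathcomp Require Import all_classical all_reals all_analysis.
From mathcomp Require Import measurable_realfun zify.
Import Order.TTheory GRing.Theory Num.Theory.
Import numFieldNormedType.Exports.
Local Open Scope classical_set_scope.
Local Open Scope ring_scope.

Set Implicit Arguments.
Unset Strict Implicit.
Unset Printing Implicit Defensive.

(** Almost surely the [N d] coordinates of the sample are algebraically independent: each one
    is independent of the previous ones and its law has no atoms, while the reals algebraic
    over the ring generated by finitely many given reals form a countable set.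

    The difference of two networks is a network [g] of width [2 r].  If [g y != 0] while [g]
    vanishes at all sample points, then replacing the coordinates of [y] by those of [X_i] one
    at a time shows that, for each [i], one coordinate of [X_i] is algebraic over the [2 r (d + 1)]
    parameters of [g], the [d] coordinates of [y] and the other coordinates of [X_i].  By Steinitz
    exchange [N d <= 2 r (d + 1) + d + N (d - 1)], which is false when [N >= 6 d r] and [r > 0].

    The exceptional event is measurable because it is the projection of the zero set of a
    function that is continuous in the finitely many real parameters. *)

(** * Algebraic dependence *)

(** The subring, not the subfield, generated by [S]: its elements are integer polynomials in [S],
    hence indexed by a countable type, and denominators can be cleared from algebraic relations. *)
Definition generated (F : fieldType) (S : seq F) : {pred F} :=
  fun z => `[< forall A : {pred F}, subring_closed A -> {subset S <= A} -> z \in A >].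

Lemma generated_subring (F : fieldType) (S : seq F) : subring_closed (generated S).
Proof.
split=> [|x y /asboolP xS /asboolP yS|x y /asboolP xS /asboolP yS];
  apply/asboolP => A cA sA; have [A1 AB AM] := cA.
- exact: A1.
- by apply: AB; [exact: xS | exact: yS].
- by apply: AM; [exact: xS | exact: yS].
Qed.

HB.instance Definition _ (F : fieldType) (S : seq F) :=
  GRing.isSubringClosed.Build F (generated S) (generated_subring S).

Lemma sub_generated (F : fieldType) (S : seq F) : {subset S <= generated S}.
Proof. by move=> x xS; apply/asboolP => A _; apply. Qed.

Lemma generated_min (F : fieldType) (S : seq F) (A : {pred F}) :
  subring_closed A -> {subset S <= A} -> {subset generated S <= A}.
Proof. by move=> cA sA x /asboolP; apply. Qed.

Lemma generated_mono (F : fieldType) (S T : seq F) :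
  {subset S <= T} -> {subset generated S <= generated T}.
Proof.
move=> sST; apply: generated_min (generated_subring T) _ => x /sST.
exact: sub_generated.
Qed.

(** For a subring [A] this is algebraicity over its field of fractions. *)
Definition algdep (F : fieldType) (A : {pred F}) (z : F) : Prop :=
  exists p : {poly F}, [/\ p != 0, p \is a polyOver A & root p z].

Lemma algdep_sub (F : fieldType) (A B : {pred F}) (z : F) :
  {subset A <= B} -> algdep A z -> algdep B z.
Proof.
move=> sAB [p [p0 pA pz]]; exists p; split=> //.
exact: polyOverS pA.
Qed.

Lemma algdep_mem (F : fieldType) (A : subringClosed F) (z : F) : z \in A -> algdep A z.
Proof.
move=> zA; exists ('X - z%:P); split; first by rewrite polyXsubC_eq0.
  by rewrite polyOverXsubC.
by rewrite root_XsubC.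
Qed.

(** * Fractions of a subring, and closure properties of algebraic elements *)

Section Fractions.
Variables (F : fieldType) (A : subringClosed F).

Definition fractions : {pred F} :=
  fun z => `[< exists a b, [/\ a \in A, b \in A, b != 0 & z = a / b] >].

Lemma fractions_divring : divring_closed fractions.
Proof.
split=> [|x y /asboolP [a [b [aA bA b0 ->]]] /asboolP [c [e [cA eA e0 ->]]]
        |x y /asboolP [a [b [aA bA b0 ->]]] /asboolP [c [e [cA eA e0 ->]]]];
  apply/asboolP.
- by exists 1, 1; rewrite !rpred1 oner_neq0 divr1.
- exists (a * e - c * b), (b * e); rewrite rpredB ?rpredM// mulf_neq0//; split=> //.
  by rewrite -[in RHS]mulNr -addf_div// mulNr.
- have [->|c0] := eqVneq c 0.
    by exists 0, 1; rewrite rpred0 rpred1 oner_neq0 !mul0r invr0 mulr0.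
  by exists (a * e), (b * c); rewrite !rpredM// mulf_neq0// invf_div mulf_div.
Qed.

HB.instance Definition _ := GRing.isDivringClosed.Build F fractions fractions_divring.

(** The field of fractions, realised inside [F] as a field type so that the theory of [integralOver]
    applies to it. *)
Definition fraction := {z : F | z \in fractions}.
HB.instance Definition _ := SubType.on fraction.
HB.instance Definition _ := Choice.on fraction.
HB.instance Definition _ := [SubChoice_isSubComUnitRing of fraction by <:].
HB.instance Definition _ := [SubComUnitRing_isSubIntegralDomain of fraction by <:].
HB.instance Definition _ := [SubIntegralDomain_isSubField of fraction by <:].

(** Horner induction: a common denominator of [p], times the denominator of the new constant
    coefficient, serves for [p * 'X + c%:P]. *)
Lemma clear_denominators (p : {poly F}) : p \is a polyOver fractions ->
  exists2 b, b != 0 & b \in A /\ b *: p \is a polyOver A.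
Proof.
elim/poly_ind: p => [|p c IHp] pA.
  by exists 1; rewrite ?oner_neq0// rpred1 scaler0 rpred0.
have pA' : p \is a polyOver fractions.
  apply/polyOverP => i; have /polyOverP/(_ i.+1) := pA.
  by rewrite coefD coefMX coefC /= addr0.
have /polyOverP/(_ 0%N) := pA; rewrite coefD coefMX coefC /= add0r.
case/asboolP => [u [v [uA vA v0 ->]]]; have [b b0 [bA bp]] := IHp pA'.
exists (b * v); first by rewrite mulf_neq0.
split; first by rewrite rpredM.
rewrite scalerDr scalerAl rpredD//.
  rewrite rpredM ?polyOverX// [b * v]mulrC -scalerA -mul_polyC rpredM//.
  by rewrite polyOverC.
by rewrite -mul_polyC -polyCM polyOverC mulrAC -mulrA divfK// rpredM.
Qed.

(** Over a field, integral and algebraic coincide; a relation over the fractions descends to [A] by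
    clearing denominators. *)
Lemma algdepP (z : F) : algdep A z <-> integralOver (val : fraction -> F) z.
Proof.
rewrite -integral_algebraic; split=> [[p [p0 pA pz]]|[p p0 pz]].
  have pK i : p`_i \in fractions.
    apply/asboolP; exists p`_i, 1.
    by rewrite rpred1 oner_neq0 divr1 (polyOverP pA).
  pose q : {poly fraction} := \poly_(i < size p) (Sub p`_i (pK i) : fraction).
  have qp : map_poly val q = p.
    apply/polyP => i; rewrite coef_map coef_poly; case: ltnP => //= ip.
    by rewrite nth_default.
  exists q; last by rewrite qp.
  by apply: contra_neq p0 => q0; rewrite -qp q0 map_poly0.
have /clear_denominators[b b0 [bA bp]] : map_poly val p \is a polyOver fractions.
  by apply/polyOverP => i; rewrite coef_map /=; exact: valP.
exists (b *: map_poly val p); split=> //; last by rewrite rootZ.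
by rewrite scaler_eq0 negb_or b0 map_poly_eq0.
Qed.

Lemma algdep_subring : subring_closed (fun z => `[< algdep A z >]).
Proof.
split=> [|x y /asboolP/algdepP xA /asboolP/algdepP yA
         |x y /asboolP/algdepP xA /asboolP/algdepP yA]; apply/asboolP.
- exact/algdep_mem/rpred1.
- exact/algdepP/integral_sub.
- exact/algdepP/integral_mul.
Qed.

Lemma algdep_root (p : {poly F}) (u : F) :
  p != 0 -> root p u -> (forall i, algdep A p`_i) -> algdep A u.
Proof.
move=> p0 pu pA; apply/algdepP/(integral_root p0 pu) => _ /(nthP 0)[i _ <-].
exact/algdepP.
Qed.

End Fractions.

(** * Transitivity and Steinitz exchange *)

(** The elements algebraic over [A] form a subring containing [S], hence containing every
    coefficient of a relation for [z]; a root of a nonzero polynomial with such coefficients is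
    again algebraic over [A]. *)
Lemma algdep_trans (F : fieldType) (S : seq F) (A : subringClosed F) (z : F) :
  {in S, forall x, algdep A x} -> algdep (generated S) z -> algdep A z.
Proof.
move=> SA [p [p0 pS pz]]; apply: (algdep_root p0 pz) => i; apply/asboolP.
apply: (generated_min (algdep_subring A) _ (polyOverP pS i)) => x xS.
exact/asboolP/SA.
Qed.

Lemma generated_cons (F : fieldType) (S : seq F) (y z : F) :
  z \in generated (y :: S) ->
  exists2 q : {poly F}, q \is a polyOver (generated S) & z = q.[y].
Proof.
pose A : {pred F} := fun z =>
  `[< exists2 q : {poly F}, q \is a polyOver (generated S) & z = q.[y] >].
suff yA : {subset generated (y :: S) <= A} by move=> /yA/asboolP.
apply: generated_min.
  split=> [|_ _ /asboolP[p pS ->] /asboolP[q qS ->]|_ _ /asboolP[p pS ->] /asboolP[q qS ->]];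
    apply/asboolP.
  - by exists 1; rewrite ?rpred1 ?hornerC.
  - by exists (p - q); rewrite ?rpredB ?hornerE.
  - by exists (p * q); rewrite ?rpredM ?hornerE.
move=> x; rewrite inE => /predU1P[->|xS]; apply/asboolP.
  by exists 'X; rewrite ?polyOverX ?hornerX.
by exists x%:P; rewrite ?polyOverC ?hornerC// sub_generated.
Qed.

(* A relation for [z] with coefficients polynomial in [y], read as a relation for [y];
   if the latter were trivial, all coefficients in [y] would give relations for [z] alone. *)
Lemma algdep_exchange (F : fieldType) (S : seq F) (y z : F) :
  algdep (generated (y :: S)) z -> ~ algdep (generated S) z ->
  algdep (generated (z :: S)) y.
Proof.
move=> [p [p0 pyS pz]] zS.
have /choice[q qP] i : exists q : {poly F}, q \is a polyOver (generated S) /\ p`_i = q.[y].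
  by have [q] := generated_cons (polyOverP pyS i); exists q.
pose h := \sum_(i < size p) z ^+ i *: q i.
exists h; split.
- apply/eqP => h0; case: zS.
  have [j pj] : exists j, \poly_(i < size p) (q i)`_j != 0.
    apply: contrapT => all0; move/eqP: p0; apply.
    apply/polyP => i; rewrite coef0 (qP i).2.
    have [ip|pi] := ltnP i (size p); last by rewrite -(qP i).2 nth_default.
    suff -> : q i = 0 by rewrite horner0.
    apply/polyP => j; rewrite coef0; apply: contrapT => qij; apply: all0; exists j.
    apply: contra_notN qij => /eqP/polyP/(_ i).
    by rewrite coef_poly ip coef0.
  exists (\poly_(i < size p) (q i)`_j); split=> //.
    by apply/polyOver_poly => i _; apply/polyOverP; case: (qP i).
  rewrite /root horner_poly; have /polyP/(_ j) := h0.
  rewrite coef0 coef_sum => sum0; apply/eqP; rewrite -[RHS]sum0.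
  by apply: eq_bigr => i _; rewrite coefZ mulrC.
- apply: rpred_sum => i _; rewrite -mul_polyC rpredM//.
    by rewrite polyOverC rpredX// sub_generated// mem_head.
  apply: polyOverS (qP i).1; apply: generated_mono => x xS.
  by rewrite inE xS orbT.
- apply/rootP; rewrite horner_sum -[RHS](rootP pz) horner_coef.
  by apply: eq_bigr => i _; rewrite hornerZ (qP i).2 mulrC.
Qed.

(** The entries of [s] are inserted one at a time, each expelling one element of [B]: the list
    [take k s ++ B'] keeps the size of [B], and all of [B] stays algebraic over it. *)
Lemma algdep_steinitz (F : fieldType) (s B : seq F) :
  (forall k, (k < size s)%N -> ~ algdep (generated (take k s)) s`_k) ->
  {in s, forall x, algdep (generated B) x} -> (size s <= size B)%N.
Proof.
move=> indep sB.
suff /(_ (size s) (leqnn _))[B' <- _] : forall k, (k <= size s)%N ->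
    exists2 B', (size B' + k = size B)%N &
      {in B, forall x, algdep (generated (take k s ++ B')) x}.
  exact: leq_addl.
elim=> [_|k IHk ks]; first by exists B; rewrite ?addn0// take0 => x xB;
  exact/algdep_mem/sub_generated.
have [B' sizeB' BB'] := IHk (ltnW ks).
have sk : algdep (generated (take k s ++ B')) s`_k.
  by apply: algdep_trans BB' _; apply/sB/mem_nth.
(* [b] is the element of [B'] at which [s_k] becomes algebraic; it exists because [s_k] is not
   algebraic over [take k s] alone. *)
have [B1 [b [B2 [B'E nB1 B1b]]]] : exists B1 b B2, [/\ B' = B1 ++ b :: B2,
    ~ algdep (generated (take k s ++ B1)) s`_k &
    algdep (generated (b :: take k s ++ B1)) s`_k].
  elim/last_ind: B' {sizeB' BB'} sk => [|B' b IHB] sk.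
    by case: (indep _ ks); rewrite cats0 in sk.
  have [/IHB[B1 [c [B2 [-> n1 c1]]]]|nB'] := pselect (algdep (generated (take k s ++ B')) s`_k).
    by exists B1, c, (rcons B2 b); rewrite rcons_cat.
  exists B', b, [::]; split=> //; first by rewrite cats1.
  apply: algdep_sub sk; apply: generated_mono => x.
  by rewrite -rcons_cat mem_rcons.
(* By exchange [b] is algebraic over [s_k], [take k s] and [B1], so [s_k] can take its place. *)
have {}B1b := algdep_exchange B1b nB1.
exists (B1 ++ B2).
  by rewrite -sizeB' B'E !size_cat /= addnS addnS addSn.
move=> x /BB'; apply: algdep_trans => y; rewrite mem_cat B'E => yB.
have [->|yb] := eqVneq y b.
  apply: algdep_sub B1b; apply: generated_mono => u.
  rewrite (take_nth 0)// !inE !mem_cat mem_rcons inE -!orbA.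
  by case/or3P => ->; rewrite ?orbT.
apply/algdep_mem/sub_generated; move: yB.
rewrite (take_nth 0)// !mem_cat mem_rcons !inE (negPf yb) /=.
by case/or3P => ->; rewrite ?orbT.
Qed.

(** * Projections along real parameters *)

(** Both strict inequalities are open conditions, so they hold on a ball around [v], which contains
    a rational point. *)
Lemma rV_rat_dense (R : realType) n (m k : R) (f : 'rV[R]_n -> R) (v : 'rV[R]_n) :
  continuous f -> f v < k -> (forall i, `|v ord0 i| < m) ->
  exists q : 'rV[rat]_n,
    f (map_mx ratr q) < k /\ forall i, `|map_mx ratr q ord0 i : R| < m.
Proof.
move=> cf fvk vm.
have : \forall u \near v, f u < k /\ forall i, `|u ord0 i| < m.
  apply: filterI; first exact: (cvgr_lt _ (cf v)).
  apply: (@filter_forall 'rV[R]_n 'I_n (fun i u => `|u ord0 i| < m) (nbhs v) _) => i.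
  apply: (cvgr_lt `|v ord0 i|) (vm i).
  by apply: cvg_norm; exact: coord_continuous.
move=> /nbhs_ballP[e /= e0 ve].
have /choice[q qP] i : exists x : rat, ratr x \in `]v ord0 i - e, v ord0 i + e[.
  by apply: rat_in_itvoo; rewrite ltrBlDr -addrA ltrDl addr_gt0.
exists (\row_i q i); apply: ve; split=> // i j.
rewrite !mxE (ord1 i) /ball /= distrC ltr_distl.
by have := qP j; rewrite in_itv.
Qed.

(* By compactness of boxes, a zero in [-m, m]^n exists as soon as |h| takes arbitrarily small
   values at rational points of the box; this turns the projection into countable operations. *)
Lemma measurable_exists_zero (R : realType) d (T : measurableType d) n
    (h : 'rV[R]_n -> T -> R) :
  (forall w, continuous (h^~ w)) -> (forall v, measurable_fun setT (h v)) ->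
  measurable [set w | exists v, h v w = 0].
Proof.
move=> ch mh.
rewrite [X in measurable X](_ : _ = \bigcup_(m : nat) \bigcap_(k : nat)
    \bigcup_(q : 'rV[rat]_n) [set w | `|h (map_mx ratr q) w| < k.+1%:R^-1 /\
      forall i, `|map_mx ratr q ord0 i : R| < m%:R]).
  apply: bigcupT_measurable => m; apply: bigcapT_measurable => k.
  apply: countable_bigcupT_measurable => // q.
  have [qm|qm] := pselect (forall i, `|map_mx ratr q ord0 i : R| < m%:R); last first.
    rewrite [X in measurable X](_ : _ = set0)//.
    by apply/seteqP; split => // w [].
  rewrite [X in measurable X](_ : _ =
    [set w | `|h (map_mx ratr q) w| < k.+1%:R^-1]).
    rewrite -[X in measurable X]setTI.
    apply: (measurable_fun_ltr (f := fun w => `|h (map_mx ratr q) w|)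
      (g := cst k.+1%:R^-1) _ _ measurableT (Y := [set true])) => //.
    exact: (measurableT_comp (@normr_measurable R setT)).
  by apply/seteqP; split => [w []|w].
apply/seteqP; split => w.
  move=> [v hv].
  have [m vm] : exists m : nat, forall i, `|v ord0 i| < m%:R.
    pose M := \sum_i `|v ord0 i|.
    exists (Num.bound M) => i.
    apply: le_lt_trans (archi_boundP (sumr_ge0 _ _)) => //.
    by rewrite /M (bigD1 i)//= lerDl sumr_ge0.
  exists m => // k _.
  have [||q [q1 q2]] := @rV_rat_dense R n m%:R (k.+1%:R^-1) (fun v => `|h v w|) v _ _ vm.
  - by move=> u; exact: (continuous_comp (ch w u) (@norm_continuous _ _ _)).
  - by rewrite hv normr0 invr_gt0.
  by exists q.
move=> [m _ wm].
pose A := [set v : 'rV[R]_n | forall i, v ord0 i \in `[- m%:R, m%:R]].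
have cA : compact A.
  apply: (@rV_compact R n (fun=> `[- m%:R, m%:R]%classic)) => _.
  exact: segment_compact.
have qA (q : 'rV[R]_n) : (forall i, `|q ord0 i| < m%:R) -> A q.
  by move=> qm i; rewrite in_itv /= -ler_norml ltW.
have A0 : A !=set0 by have [q _ [_ /qA]] := wm 0%N I; exists (map_mx ratr q).
have [|c cAc cmin] := @EVT_min_rV R n (fun v => `|h v w|) A A0 cA.
  apply: continuous_subspaceT => u; exact: (continuous_comp (ch w u) (@norm_continuous _ _ _)).
exists c; apply/eqP; rewrite -normr_le0 leNgt; apply/negP => hc0.
(* If the minimum over the box were positive, this [k] would put [1 / (k + 1)] below it, yet some
   rational point of the box has a value below [1 / (k + 1)]. *)
pose k := Num.bound (`|h c w|^-1).
have [q _ [hq /qA/mem_set/cmin hcq]] := wm k I.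
have := le_lt_trans hcq hq; apply/negP; rewrite -leNgt.
rewrite invf_ple ?posrE ?ltr0n//.
have : `|h c w|^-1 < k%:R by apply: archi_boundP; rewrite invr_ge0.
by move=> /ltW /le_trans; apply; rewrite ler_nat.
Qed.

(** * Algebraic independence of independent atomless variables *)

Lemma negligible_countable_bigcup d (T : measurableType d) (R : realType)
    (mu : {measure set T -> \bar R}) (I : countType) (F : I -> set T) :
  (forall i, mu.-negligible (F i)) -> mu.-negligible (\bigcup_i F i).
Proof.
move=> F0; pose G k := if unpickle k is Some i then F i else set0.
apply: (@negligibleS _ _ _ mu (\bigcup_k G k)).
  by move=> x [i _ Fix]; exists (pickle i) => //; rewrite /G pickleK.
apply: negligible_bigcup => k; rewrite /G.
by case: unpickle => [i|]; [exact: F0|exact: negligible_set0].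
Qed.

(** Induction on the size of [p]: splitting off a root removes a single point, which is not an
    atom. *)
Lemma negligible_roots (R : realType) (D : probability (measurableTypeR R) R) (p : {poly R}) :
  (forall x : R, D [set x] = 0%E) -> p != 0 -> D.-negligible [set x | root p x].
Proof.
move=> D0; have [n] := ubnP (size p); elim: n p => // n IHn p pn p0.
have [[a pa]|nroot] := pselect (exists a, root p a); last first.
  apply: negligibleS (negligible_set0 D) => x px.
  by apply: nroot; exists x.
have [q pq] := factor_theorem _ _ pa.
have q0 : q != 0 by apply: contra_neq p0 => q0; rewrite pq q0 mul0r.
apply: (@negligibleS _ _ _ D ([set x | root q x] `|` [set a])).
  by move=> x /=; rewrite pq rootM root_XsubC => /orP[->|/eqP ->]; [left|right].
apply: negligibleU; last exact/negligibleP/D0.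
apply: IHn => //; rewrite -ltnS (leq_trans _ pn)// pq size_Mmonic ?monicXsubC//.
by rewrite size_XsubC addn2.
Qed.

Lemma density_atomless (R : realType) (D : probability (measurableTypeR R) R) (f : R -> R) :
  has_density D f -> forall x : R, D [set x] = 0%E.
Proof. by move=> [_ _ Df] x; rewrite Df// integral_set1. Qed.

(** Boxes form a generating system stable under intersection. Their sides are indexed by [nat], so
    that boxes of different dimensions can share one family. *)
Lemma measure_tuple_unique (R : realType) n
    (m1 m2 : {measure set (n.-tuple (measurableTypeR R)) -> \bar R}) :
  (m1 setT < +oo)%E ->
  (forall B : nat -> set (measurableTypeR R), (forall j, measurable (B j)) ->
    m1 [set x | forall j : 'I_n, B j (tnth x j)] =
    m2 [set x | forall j : 'I_n, B j (tnth x j)]) ->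
  forall A, measurable A -> m1 A = m2 A.
Proof.
move=> m1oo m12.
pose C : set (set (n.-tuple (measurableTypeR R))) :=
  [set A | exists B : nat -> set (measurableTypeR R),
    (forall j, measurable (B j)) /\ A = [set x | forall j : 'I_n, B j (tnth x j)]].
have mC A : C A -> measurable A.
  move=> [B [mB ->]].
  rewrite [X in measurable X](_ : _ =
    \bigcap_(j in [set: 'I_n]) ((fun x : n.-tuple (measurableTypeR R) => tnth x j) @^-1` B j)).
    apply: fin_bigcap_measurable; first exact: finite_finset.
    move=> j _; rewrite -[X in measurable X]setTI.
    exact: (measurable_tnth j measurableT (mB j)).
  by apply/seteqP; split => x Bx; [move=> j _; exact: Bx|move=> j; exact: (Bx j)].
apply: (measure_unique C (fun=> setT)).
- apply/seteqP; split.
  + apply: sub_sigma_algebra2 => A; rewrite -bigcup_seq => -[j _ [B mB <-]].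
    exists (fun i => if i == j :> nat then B else setT); split.
      by move=> i; case: ifP.
    apply/seteqP; split => [x [_ Bx] i|x Bx].
      by case: eqP => // ij; have -> : i = j by exact: val_inj.
    by split=> //; have := Bx j; rewrite eqxx.
  + by apply: smallest_sub; [exact: sigma_algebra_measurable|exact: mC].
- move=> _ _ [B1 [mB1 ->]] [B2 [mB2 ->]]; exists (fun j => B1 j `&` B2 j); split.
    by move=> j; exact: measurableI.
  apply/seteqP; split => [x [x1 x2] j|x x12]; first by split; [exact: x1|exact: x2].
  by split=> j; case: (x12 j).
- by move=> _; exists (fun=> setT); split=> //; apply/seteqP; split.
- by rewrite bigcup_const.
- by move=> A [B [mB ->]]; exact: m12.
- by [].
Qed.

(** The factorisation makes the law of [(Z, Y)] the product of the law of [Z] and [D]; the measure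
    of [G] is then the integral of the measures of its sections. *)
Lemma indep_sections_null d d1 d2 (Omega : measurableType d) (T1 : measurableType d1)
    (T2 : measurableType d2) (R : realType) (P : probability Omega R)
    (D : probability T2 R) (Z : Omega -> T1) (Y : Omega -> T2) (G : set (T1 * T2)) :
  measurable_fun setT Z -> measurable_fun setT Y ->
  (forall A B, measurable A -> measurable B ->
     P (Z @^-1` A `&` Y @^-1` B) = (P (Z @^-1` A) * D B)%E) ->
  measurable G -> (forall z, D (xsection G z) = 0%E) ->
  P.-negligible [set w | G (Z w, Y w)].
Proof.
move=> mZ mY ZY mG G0.
have mZY : measurable_fun setT (fun w => (Z w, Y w)) by exact: measurable_fun_pair.
apply/negligibleP.
  by rewrite -[X in measurable X]setTI; exact: mZY.
pose Zm : {mfun Omega >-> T1} := HB.pack Z (isMeasurableFun.Build _ _ _ _ Z mZ).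
pose ZYm : {mfun Omega >-> (T1 * T2)%type} :=
  HB.pack (fun w => (Z w, Y w)) (isMeasurableFun.Build _ _ _ _ _ mZY).
rewrite -[LHS]/(distribution P ZYm G).
rewrite -(@product_measure_unique _ _ T1 T2 R (distribution P Zm) D (distribution P ZYm) _ G mG).
  by rewrite /product_measure1 integral0_eq// => z _; exact: G0.
by move=> A B mA mB; exact: ZY.
Qed.

(* Integer polynomials in [n] variables, as a countable type of lists of monomials. *)
Definition zmpoly n := seq (int * {ffun 'I_n -> nat}).

Definition zmeval (F : fieldType) n (c : zmpoly n) (z : n.-tuple F) : F :=
  \sum_(t <- c) t.1%:~R * \prod_(i < n) tnth z i ^+ t.2 i.

Lemma generated_zmeval (F : fieldType) n (z : n.-tuple F) x :
  x \in generated z -> exists c : zmpoly n, x = zmeval c z.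
Proof.
pose A : {pred F} := fun x => `[< exists c : zmpoly n, x = zmeval c z >].
suff zA : {subset generated z <= A} by move=> /zA/asboolP.
apply: generated_min; last first.
  move=> _ /tnthP[i ->]; apply/asboolP.
  exists [:: (1%Z, [ffun j => nat_of_bool (j == i)])].
  rewrite /zmeval big_seq1 /= mul1r (bigD1 i)//= ffunE eqxx expr1 big1 ?mulr1//.
  by move=> j /negPf ji; rewrite ffunE ji expr0.
split=> [|_ _ /asboolP[c ->] /asboolP[e ->]|_ _ /asboolP[c ->] /asboolP[e ->]]; apply/asboolP.
- exists [:: (1%Z, [ffun=> 0%N])]; rewrite /zmeval big_seq1 /= mul1r big1//.
  by move=> j _; rewrite ffunE.
- exists (c ++ [seq (- t.1, t.2) | t <- e]); rewrite /zmeval big_cat big_map /=; congr (_ + _).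
  by rewrite -sumrN; apply: eq_bigr => t _; rewrite mulrNz mulNr.
- exists (allpairs (fun s t : int * {ffun 'I_n -> nat} =>
    (s.1 * t.1, [ffun i => (s.2 i + t.2 i)%N])) c e).
  rewrite /zmeval big_allpairs_dep mulr_suml; apply: eq_bigr => s _ /=.
  rewrite mulr_sumr; apply: eq_bigr => t _ /=; rewrite intrM mulrACA; congr (_ * _).
  by rewrite -big_split; apply: eq_bigr => i _; rewrite ffunE exprD.
Qed.

Lemma measurable_zmeval (R : realType) n (c : zmpoly n) :
  measurable_fun setT (fun z : n.-tuple (measurableTypeR R) => zmeval c z : measurableTypeR R).
Proof.
apply: measurable_sum => t; apply: measurable_funM => //.
apply: measurable_prod => i _; apply: measurable_funX.
exact: measurable_tnth.
Qed.

(** A relation has finitely many coefficients, each an integer polynomial in [Z w], so countably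
    many events cover the dependence; for fixed [z], each leaves only finitely many values of
    [Y]. *)
Lemma negligible_algdep d (Omega : measurableType d) (R : realType) (P : probability Omega R)
    (D : probability (measurableTypeR R) R) n
    (Z : Omega -> n.-tuple (measurableTypeR R)) (Y : Omega -> measurableTypeR R) :
  (forall x : R, D [set x] = 0%E) ->
  measurable_fun setT Z -> measurable_fun setT Y ->
  (forall A B, measurable A -> measurable B ->
     P (Z @^-1` A `&` Y @^-1` B) = (P (Z @^-1` A) * D B)%E) ->
  P.-negligible [set w | algdep (generated (Z w : seq R)) (Y w : R)].
Proof.
move=> D0 mZ mY ZY.
(* [cs] lists the coefficients of the relation, and the first clause makes it nontrivial at [z].
   Past the end of [cs] the default [[::]] evaluates to 0, so [i] may range over all of [nat]. *)
pose G (cs : seq (zmpoly n)) : set (n.-tuple (measurableTypeR R) * measurableTypeR R) :=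
  (\bigcup_i [set zy | zmeval (nth [::] cs i) zy.1 != 0 :> R]) `&`
  [set zy | \sum_(i < size cs) zmeval (nth [::] cs i) zy.1 * zy.2 ^+ i == 0 :> R].
have mev c : measurable_fun setT (fun zy : n.-tuple (measurableTypeR R) * measurableTypeR R =>
    zmeval c zy.1 : measurableTypeR R).
  by apply: measurableT_comp; [exact: measurable_zmeval|exact: measurable_fst].
have G0 cs z : D.-negligible (xsection (G cs) z).
  pose p : {poly R} := \poly_(i < size cs) zmeval (nth [::] cs i) z.
  have [p0|p0] := eqVneq p 0; last first.
    apply: negligibleS (negligible_roots D0 p0) => y; rewrite /xsection/= inE => -[_ /=].
    by rewrite /root horner_poly.
  rewrite (_ : xsection _ _ = set0); first exact: negligible_set0.
  apply/seteqP; split => // y; rewrite /xsection/= inE => -[[i _ /= ci] _].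
  have /polyP/(_ i) := p0; rewrite coef_poly coef0; case: ltnP => [_|ic].
    by move/eqP: ci.
  by move: ci; rewrite nth_default// /zmeval big_nil eqxx.
have mG cs : measurable (G cs).
  apply: measurableI.
    apply: bigcupT_measurable => i; rewrite -[X in measurable X]setTI.
    rewrite (_ : [set _ | _] = [set zy | (zmeval (nth [::] cs i) zy.1 == 0 :> R) = false]).
      exact: (measurable_fun_eqr (g := cst 0) (mev _) _ measurableT (Y := [set false])).
    by apply/seteqP; split => zy /=; [exact: negbTE|move=> ->].
  rewrite -[X in measurable X]setTI.
  apply: (measurable_fun_eqr (g := cst 0) _ _ measurableT (Y := [set true])) => //.
  apply: measurable_sum => i; apply: measurable_funM; first exact: mev.
  by apply: measurable_funX; exact: measurable_snd.
apply: (@negligibleS _ _ _ P (\bigcup_cs [set w | G cs (Z w, Y w)])); last first.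
  apply: negligible_countable_bigcup => cs.
  apply: (indep_sections_null mZ mY ZY (mG cs)) => z.
  apply/negligibleP; [exact: measurable_xsection|exact: G0].
move=> w [p [p0 pZ pY]].
have /choice[c cP] i : exists c : zmpoly n, p`_i = zmeval c (Z w).
  exact/generated_zmeval/(polyOverP pZ).
have nc i : (i < size p)%N -> nth [::] (mkseq c (size p)) i = c i by move=> ip; rewrite nth_mkseq.
exists (mkseq c (size p)) => //; split.
  exists (size p).-1 => //=; rewrite nc ?ltn_predL ?size_poly_gt0// -cP.
  by rewrite -[_`__]/(lead_coef p) lead_coef_eq0.
rewrite /= size_mkseq; move: pY; rewrite /root horner_coef => /eqP pY.
by apply/eqP; rewrite -[RHS]pY; apply: eq_bigr => i _; rewrite nc// cP.
Qed.

Lemma nth_codom_ord (T : Type) (x0 : T) n (f : 'I_n -> T) (i : 'I_n) :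
  nth x0 (codom f) i = f i.
Proof. by rewrite codomE (nth_map i) ?nth_ord_enum// size_enum_ord. Qed.

(** For each of the finitely many [m], the vector [Z] of the variables before [u m] is independent
    of [u m]. The product formula on boxes yields this first for boxes, then for all measurable sets
    by uniqueness of measures. *)
Lemma iid_not_algdep d (Omega : measurableType d) (R : realType) (P : probability Omega R)
    (D : probability (measurableTypeR R) R) n (u : 'I_n -> Omega -> measurableTypeR R) :
  (forall x : R, D [set x] = 0%E) ->
  (forall j, measurable_fun setT (u j)) ->
  (forall B : nat -> set (measurableTypeR R), (forall j, measurable (B j)) ->
     P [set w | forall j : 'I_n, B j (u j w)] = (\prod_(j < n) D (B j))%E) ->
  P.-negligible [set w | exists2 m, (m < n)%N &
    algdep (generated (take m (codom (u^~ w)) : seq R)) (codom (u^~ w))`_m].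
Proof.
move=> D0 mu uD.
apply: (@negligibleS _ _ _ P (\bigcup_(m : 'I_n) [set w |
    algdep (generated (take m (codom (u^~ w)) : seq R)) (u m w : R)])).
  move=> w [m mn alg]; exists (Ordinal mn) => //=; move: alg.
  by rewrite -[in X in _ -> X](@nth_codom_ord R 0 n (u^~ w) (Ordinal mn)).
apply: negligible_countable_bigcup => m.
pose w_ (j : 'I_m) : 'I_n := widen_ord (ltnW (ltn_ord m)) j.
pose Z w : m.-tuple (measurableTypeR R) := [tuple u (w_ j) w | j < m].
have ZE w : take m (codom (u^~ w)) = Z w :> seq R.
  apply: (@eq_from_nth _ (0 : R)).
    by rewrite size_take size_codom card_ord size_tuple ltn_ord.
  rewrite size_take size_codom card_ord ltn_ord => i im.
  rewrite nth_take//.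
  have inn : (i < n)%N := ltn_trans im (ltn_ord m).
  rewrite (@nth_codom_ord R 0 n (u^~ w) (Ordinal inn)).
  rewrite -(@tnth_nth _ R _ (Z w) (Ordinal im)) tnth_mktuple; congr (u _ w).
  exact: val_inj.
have -> : [set w | algdep (generated (take m (codom (u^~ w)) : seq R)) (u m w : R)] =
    [set w | algdep (generated (Z w : seq R)) (u m w : R)].
  by apply/seteqP; split => w /=; rewrite ZE.
have mZ : measurable_fun setT Z.
  apply/measurable_fun_tnthP => j.
  rewrite (_ : _ \o _ = u (w_ j)); first exact: mu.
  by apply/funext => w /=; rewrite tnth_mktuple.
apply: (negligible_algdep D0 mZ (mu m)) => A B mA mB.
have mYB : measurable (u m @^-1` B).
  by rewrite -[X in measurable X]setTI; exact: mu.
have box B' C : (forall j : nat, measurable (B' j)) -> measurable C ->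
    P ([set w | forall j : 'I_m, B' j (tnth (Z w) j)] `&` u m @^-1` C) =
    (\prod_(j < m) D (B' j) * D C)%E.
  move=> mB' mC.
  (* Variables beyond [m] are left unconstrained and contribute factors 1. *)
  pose B2 j := if (j < m)%N then B' j else if (j == m)%N then C else setT.
  have -> : [set w | forall j : 'I_m, B' j (tnth (Z w) j)] `&` u m @^-1` C =
      [set w | forall j : 'I_n, B2 j (u j w)].
    apply/seteqP; split => [w [wB wC] j|w wB2]; rewrite /B2.
      case: ltnP => [jm|mj]; last first.
        by case: eqP => // /val_inj ->.
      have := wB (Ordinal jm); rewrite tnth_mktuple (_ : w_ _ = j)//.
      exact: val_inj.
    split=> [j|].
      by rewrite tnth_mktuple; have := wB2 (w_ j); rewrite /B2 /= ltn_ord.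
    by have := wB2 m; rewrite /B2 ltnn eqxx.
  rewrite uD; last first.
    by move=> j; rewrite /B2; case: ifP => // _; case: ifP.
  rewrite -(big_mkord xpredT (fun j => D (B2 j))) (big_cat_nat (leq0n m) (ltnW (ltn_ord m))) /=.
  rewrite big_mkord (eq_bigr (fun j : 'I_m => D (B' j))); last first.
    by move=> j _; rewrite /B2 ltn_ord.
  congr (_ * _)%E; rewrite big_ltn// {1}/B2 ltnn eqxx.
  rewrite big_nat big1 ?mule1// => j /andP[mj _].
  by rewrite /B2 ltnNge ltnW//= gtn_eqF// probability_setT.
(* With [B] fixed, both sides of the independence identity are finite measures in [A], so comparing
   them on boxes suffices. *)
pose m1 := mrestr P mYB.
pose m2 := mscale (NngNum (fine_ge0 (measure_ge0 D B))) P.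
have Db : ((fine (D B))%:E = D B)%E by rewrite fineK// fin_num_measure.
have m12 : pushforward m1 Z A = pushforward m2 Z A.
  apply: (@measure_tuple_unique R m (pushforward m1 Z) (pushforward m2 Z)) => //.
    rewrite /= /pushforward /mrestr preimage_setT setTI.
    by rewrite (le_lt_trans (probability_le1 P mYB))// ltry.
  move=> B' mB'.
  have := box B' setT mB' measurableT.
  rewrite preimage_setT setIT probability_setT mule1 => PB'.
  transitivity (P ([set w | forall j : 'I_m, B' j (tnth (Z w) j)] `&` u m @^-1` B)) => //.
  by rewrite box// -PB' -Db muleC.
transitivity (pushforward m1 Z A) => //.
by rewrite m12 -Db muleC.
Qed.

(** * Networks vanishing on the sample *)

(* Replacing the coordinates of [y] by those of [x] one at a time, the value of the network
   vanishes for the first time at some step [k], and then [x_k] is a root of a nonzero polynomial. *)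
Lemma network_zero_algdep (R : realType) (l d r : nat) (a : 'I_r -> R)
    (W : 'I_r -> d.-tuple R) (x y : d.-tuple R) :
  \sum_(j < r) a j * dotp (W j) x ^+ l = 0 -> \sum_(j < r) a j * dotp (W j) y ^+ l != 0 ->
  exists k : 'I_d, forall A : subringClosed R,
    (forall j, a j \in A) -> (forall j c, tnth (W j) c \in A) ->
    (forall c, tnth y c \in A) -> (forall c, c != k -> tnth x c \in A) ->
    algdep A (tnth x k).
Proof.
move=> gx0 gy0.
pose z k : d.-tuple R := [tuple (if (c < k)%N then tnth x c else tnth y c) | c < d].
pose g (u : d.-tuple R) := \sum_(j < r) a j * dotp (W j) u ^+ l.
have [k gk gk1] : exists2 k : 'I_d, g (z k) != 0 & g (z k.+1) = 0.
  apply: contrapT => nk.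
  have : forall k, (k <= d)%N -> g (z k) != 0.
    elim=> [_|k IHk kd].
      rewrite (_ : z 0%N = y)//; apply: eq_from_tnth => c.
      by rewrite tnth_mktuple ltn0.
    apply/eqP => gk1; apply: nk; exists (Ordinal kd) => //.
    exact/IHk/ltnW.
  move=> /(_ d (leqnn d)) /eqP; apply; rewrite (_ : z d = x)//.
  by apply: eq_from_tnth => c; rewrite tnth_mktuple ltn_ord.
exists k => A aA WA yA xA.
(* The network at [z k] with coordinate [k] made indeterminate: its value at [y_k] is [g (z k)],
   nonzero, and at [x_k] it is [g (z k.+1) = 0]. *)
pose p : {poly R} := \sum_(j < r) (a j)%:P *
  (\sum_(c < d) (tnth (W j) c)%:P * (if c == k then 'X else (tnth (z k) c)%:P)) ^+ l.
have pE u : p.[u] = \sum_(j < r) a j *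
    (\sum_(c < d) tnth (W j) c * (if c == k then u else tnth (z k) c)) ^+ l.
  rewrite horner_sum; apply: eq_bigr => j _; rewrite hornerM hornerC horner_exp horner_sum.
  congr (_ * _ ^+ _); apply: eq_bigr => c _; rewrite hornerM hornerC.
  by case: ifP => _; rewrite ?hornerX ?hornerC.
have zA c : c != k -> tnth (z k) c \in A.
  by move=> ck; rewrite tnth_mktuple; case: ifP => _; [exact: xA|exact: yA].
exists p; split.
- apply/eqP => p0; move: gk; apply/negP; rewrite negbK; apply/eqP.
  rewrite -[RHS](horner0 (tnth y k)) -p0 pE; apply: eq_bigr => j _.
  congr (_ * _ ^+ _); apply: eq_bigr => c _; case: eqP => // ->.
  by rewrite tnth_mktuple ltnn.
- apply: rpred_sum => j _; rewrite rpredM ?polyOverC// rpredX// rpred_sum// => c _.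
  rewrite rpredM ?polyOverC//; case: ifPn => [_|/zA]; first exact: polyOverX.
  by rewrite polyOverC.
- apply/rootP; rewrite pE -[RHS]gk1; apply: eq_bigr => j _.
  congr (_ * _ ^+ _); apply: eq_bigr => c _; rewrite !tnth_mktuple [RHS]/= ltnS.
  by case: eqP => [->|/eqP ck]; rewrite ?leqnn// ltn_neqAle (inj_eq (@ord_inj d)) ck.
Qed.

(** All [N d] coordinates are algebraic over a list [B] of size [r + r d + d + N (d - 1)], which is
    below [N d] exactly when [N > r (d + 1) + d]; Steinitz then excludes independence. *)
Lemma network_zeros_algdep (R : realType) (l d r N : nat) (x : 'I_N -> d.-tuple R)
    (g : d.-tuple R -> R) (y : d.-tuple R) :
  (0 < d)%N -> (r * d.+1 + d < N)%N ->
  network l r g -> (forall i, g (x i) = 0) -> g y != 0 ->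
  let s := codom (fun j : 'I_#|{: 'I_N * 'I_d}| => tnth (x (enum_val j).1) (enum_val j).2) in
  exists2 m, (m < #|{: 'I_N * 'I_d}|)%N & algdep (generated (take m s)) s`_m.
Proof.
(* With the dimension a successor, [lift (k i)] enumerates the coordinates other than [k i]. *)
case: d x g y => // d x g y _ rN [a [W gE]] gx gy s.
apply: contrapT => indep.
have /choice[k kP] i := network_zero_algdep (esym (etrans (esym (gx i)) (gE (x i))))
  (eq_ind _ (fun t => t != 0) gy _ (gE y)).
pose B := codom a ++ codom (fun p : 'I_r * 'I_d.+1 => tnth (W p.1) p.2) ++ y ++
  codom (fun p : 'I_N * 'I_d => tnth (x p.1) (lift (k p.1) p.2)).
have size_s : size s = (N * d.+1)%N by rewrite size_codom card_ord card_prod !card_ord.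
have size_B : size B = (r + (r * d.+1 + (d.+1 + N * d)))%N.
  by rewrite !size_cat !size_codom size_tuple !card_prod !card_ord.
suff : (size s <= size B)%N.
  rewrite size_s size_B; move: rN; nia.
apply: algdep_steinitz => [m ms alg|].
  by apply: indep; exists m => //; move: ms; rewrite size_codom card_ord.
have xB i c : c != k i -> tnth (x i) c \in B.
  rewrite eq_sym => /unlift_some[c' cE _]; rewrite !mem_cat cE.
  by rewrite (@codom_f _ _ (fun p : 'I_N * 'I_d => tnth (x p.1) (lift (k p.1) p.2)) (i, c')) !orbT.
have xalg i c : algdep (generated B) (tnth (x i) c).
  have [->|ck] := eqVneq c (k i); last exact/algdep_mem/sub_generated/xB.
  apply: kP => [j|j e|e|e ek]; apply: sub_generated; last exact: xB.
  - by rewrite mem_cat codom_f.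
  - rewrite !mem_cat.
    by rewrite (@codom_f _ _ (fun p : 'I_r * 'I_d.+1 => tnth (W p.1) p.2) (j, e)) !orbT.
  - by rewrite !mem_cat mem_tnth !orbT.
by move=> _ /codomP[j ->]; exact: xalg.
Qed.

(** * Uniqueness in terms of networks of double width *)

Lemma network_sub (R : realType) (l d r : nat) (f g : d.-tuple R -> R) :
  network l r f -> network l r g -> network l (r + r) (fun x => f x - g x).
Proof.
move=> [a [W fE]] [b [V gE]].
exists (fun j => match fintype.split j with inl i => a i | inr i => - b i end),
  (fun j => match fintype.split j with inl i => W i | inr i => V i end) => x.
rewrite fE gE big_split_ord /=; congr (_ + _).
  by apply: eq_bigr => j _; rewrite (unsplitK (inl j)).
by rewrite -sumrN; apply: eq_bigr => j _; rewrite (unsplitK (inr j)) mulNr.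
Qed.

Lemma network_split (R : realType) (l d r : nat) (h : d.-tuple R -> R) :
  network l (r + r) h -> exists f g, [/\ network l r f, network l r g &
    forall x, h x = f x - g x].
Proof.
move=> [a [W hE]].
exists (fun x => \sum_(j < r) a (lshift r j) * dotp (W (lshift r j)) x ^+ l),
  (fun x => \sum_(j < r) - a (rshift r j) * dotp (W (rshift r j)) x ^+ l); split.
- by exists (a \o lshift r), (W \o lshift r).
- by exists (fun j => - a (rshift r j)), (W \o @rshift r r).
move=> x; rewrite hE big_split_ord -sumrN; congr (_ + _).
by apply: eq_bigr => j _; rewrite mulNr opprK.
Qed.

(** Differences of two networks of width [r] are exactly the networks of width [r + r], so
    non-uniqueness becomes the existence of finitely many real parameters. *)
Lemma unique_interpolation (R : realType) (l d r : nat) (I : Type) (x : I -> d.-tuple R) :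
  (forall fstar, network l r fstar ->
     [set f | network l r f /\ forall i, f (x i) = fstar (x i)] = [set fstar]) <->
  ~ exists2 h, network l (r + r) h & (forall i, h (x i) = 0) /\ exists y, h y != 0.
Proof.
split=> [uniq [h /network_split[f [g [fn gn hE]]] [hx [y hy]]]|nh fstar nfstar].
  have : [set f | network l r f /\ forall i, f (x i) = g (x i)] f.
    by split=> // i; apply/eqP; rewrite -subr_eq0 -hE hx.
  by rewrite uniq// => fg; move: hy; rewrite hE fg subrr eqxx.
apply/seteqP; split => [f [nf fx]|f ->]; last by split.
apply/funext => y; apply: contrapT => fy; apply: nh.
exists (fun x => f x - fstar x); first exact: network_sub.
split=> [i|]; first by rewrite fx subrr.
by exists y; rewrite subr_eq0; apply/eqP.
Qed.

(** * Measurability of the exceptional event *)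

Lemma continuous_sum (T : topologicalType) (R : realType) (I : Type) (s : seq I)
    (f : I -> T -> R) :
  (forall i, continuous (f i)) -> continuous (fun x => \sum_(i <- s) f i x).
Proof.
move=> cf; elim: s => [|i s IHs].
  by under eq_fun do rewrite big_nil; exact: cst_continuous.
under eq_fun do rewrite big_cons.
by move=> x; apply: continuousD; [exact: cf|exact: IHs].
Qed.

Lemma continuous_add (T : topologicalType) (R : realType) (f g : T -> R) :
  continuous f -> continuous g -> continuous (fun x => f x + g x).
Proof. by move=> cf cg x; apply: continuousD; [exact: cf|exact: cg]. Qed.

Lemma continuous_mul (T : topologicalType) (R : realType) (f g : T -> R) :
  continuous f -> continuous g -> continuous (fun x => f x * g x).
Proof. by move=> cf cg x; apply: continuousM; [exact: cf|exact: cg]. Qed.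

Lemma continuous_exp (T : topologicalType) (R : realType) (f : T -> R) k :
  continuous f -> continuous (fun x => f x ^+ k).
Proof.
move=> cf; elim: k => [|k IHk].
  by under eq_fun do rewrite expr0; exact: cst_continuous.
by under eq_fun do rewrite exprS; exact: continuous_mul.
Qed.

(** One real vector holds the weights, the point [y] and a scalar [s]; the open condition that the
    network is nonzero at [y] becomes the equation saying that [s] times its value there is 1. *)
Lemma measurable_vanishing_network d0 (Omega : measurableType d0) (R : realType)
    (l d r N : nat) (X : 'I_N -> Omega -> d.-tuple (measurableTypeR R)) :
  (forall i, measurable_fun setT (X i)) ->
  measurable [set w | exists2 h : d.-tuple R -> R, network l r h &
    (forall i, h (X i w) = 0) /\ exists y, h y != 0].
Proof.
move=> mX.
pose J : finType := ('I_r + 'I_r * 'I_d + 'I_d + unit)%type.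
pose co (v : 'rV[R]_#|J|) (j : J) : R := v ord0 (enum_rank j).
have cco j : continuous (co ^~ j) by exact: coord_continuous.
pose net (v : 'rV[R]_#|J|) (x : 'I_d -> R) : R := \sum_(j < r) co v (inl (inl (inl j))) *
  (\sum_(c < d) co v (inl (inl (inr (j, c)))) * x c) ^+ l.
(* A sum of squares merges all the equations into one. *)
pose h v w : R := (co v (inr tt) * net v (fun c => co v (inl (inr c))) - 1) ^+ 2 +
  \sum_(i < N) net v (fun c => tnth (X i w : d.-tuple R) c) ^+ 2.
have cnet (x : 'I_d -> 'rV[R]_#|J| -> R) : (forall c, continuous (x c)) ->
    continuous (fun v => net v (x ^~ v)).
  move=> cx; apply: continuous_sum => j; apply: continuous_mul; first exact: cco.
  apply: continuous_exp; apply: continuous_sum => c; exact: continuous_mul.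
rewrite [X in measurable X](_ : _ = [set w | exists v, h v w = 0]).
  apply: measurable_exists_zero => [w|v].
    apply: continuous_add.
      apply: continuous_exp; apply: continuous_add; last exact: cst_continuous.
      apply: continuous_mul; first exact: cco.
      by apply: cnet => c; exact: cco.
    apply: continuous_sum => i; apply: continuous_exp.
    by apply: cnet => c; exact: cst_continuous.
  apply: measurable_funD; first exact: measurable_cst.
  apply: measurable_sum => i; apply: measurable_funX.
  apply: measurable_sum => j; apply: measurable_funM; first exact: measurable_cst.
  apply: measurable_funX; apply: measurable_sum => c.
  apply: measurable_funM; first exact: measurable_cst.
  exact: (measurableT_comp (measurable_tnth c) (mX i)).
apply/seteqP; split => w /=.
  move=> [f [a [W fE]] [fX [y fy]]].
  pose t (j : J) : R := match j with
    | inl (inl (inl j)) => a j | inl (inl (inr p)) => tnth (W p.1) p.2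
    | inl (inr c) => tnth y c | inr _ => (f y)^-1 end.
  exists (\row_j t (enum_val j)).
  have coE j : co (\row_j t (enum_val j)) j = t j by rewrite /co mxE enum_rankK.
  have netE x : net (\row_j t (enum_val j)) (tnth x) = f x.
    rewrite fE; apply: eq_bigr => j _; rewrite coE; congr (_ * _ ^+ _).
    by apply: eq_bigr => c _; rewrite coE.
  rewrite /h big1 => [|i _]; last by rewrite netE fX expr0n.
  rewrite (_ : (fun c => _) = tnth y); last by apply/funext => c; rewrite coE.
  by rewrite netE coE /= mulVf// subrr expr0n addr0.
move=> [v /eqP]; rewrite /h paddr_eq0 ?sqr_ge0//; last first.
  by apply: sumr_ge0 => i _; rewrite sqr_ge0.
rewrite psumr_eq0; last by move=> i _; rewrite sqr_ge0.
rewrite sqrf_eq0 subr_eq0 => /andP[/eqP sy /allP Xv].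
pose W j : d.-tuple R := [tuple co v (inl (inl (inr (j, c)))) | c < d].
have netE x : net v (tnth x) = \sum_(j < r) co v (inl (inl (inl j))) * dotp (W j) x ^+ l.
  apply: eq_bigr => j _; congr (_ * _ ^+ _); apply: eq_bigr => c _.
  by rewrite tnth_mktuple.
exists (net v \o @tnth d R); first by exists (fun j => co v (inl (inl (inl j)))), W => x; exact: netE.
split=> [i|].
  by have := Xv i (mem_index_enum i); rewrite sqrf_eq0 => /eqP.
exists [tuple co v (inl (inr c)) | c < d] => /=.
rewrite (_ : tnth _ = fun c => co v (inl (inr c))); last first.
  by apply/funext => c; rewrite tnth_mktuple.
by apply/eqP => n0; move: sy; rewrite n0 mulr0 => /esym/eqP; rewrite oner_eq0.
Qed.

(** * Law of the flattened sample, and conclusion *)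

(** A box in the flattened coordinates is an intersection of one box per sample vector: independence
    splits it over [i], and the product law of [X i] over the coordinates. *)
Lemma coordinates_iid (R : realType) (d N : nat) (D : probability (measurableTypeR R) R)
    (dO : measure_display) (Omega : measurableType dO) (P : probability Omega R)
    (X : 'I_N -> {RV P >-> d.-tuple (measurableTypeR R)}) :
  mutually_independent X -> (forall i, is_power_measure D (distribution P (X i))) ->
  forall B : nat -> set (measurableTypeR R), (forall j, measurable (B j)) ->
  P [set w | forall j : 'I_#|{: 'I_N * 'I_d}|, B j (tnth (X (enum_val j).1 w) (enum_val j).2)] =
  (\prod_(j < #|{: 'I_N * 'I_d}|) D (B j))%E.
Proof.
move=> indX powX B mB.
pose Bx (i : 'I_N) : set (d.-tuple (measurableTypeR R)) :=
  [set x | forall c : 'I_d, B (enum_rank (i, c)) (tnth x c)].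
have mBx i : measurable (Bx i).
  rewrite [X in measurable X](_ : _ = \bigcap_(c in [set: 'I_d])
      ((fun x : d.-tuple (measurableTypeR R) => tnth x c) @^-1` B (enum_rank (i, c)))).
    apply: fin_bigcap_measurable; first exact: finite_finset.
    by move=> c _; rewrite -[X in measurable X]setTI; exact: (measurable_tnth c measurableT).
  by apply/seteqP; split => x xB; [move=> c _; exact: xB|move=> c; exact: (xB c)].
have := indX [set: 'I_N]%SET Bx mBx.
rewrite (_ : [set w | _] = [set w | forall j : 'I_#|{: 'I_N * 'I_d}|,
    B j (tnth (X (enum_val j).1 w) (enum_val j).2)]); last first.
  apply/seteqP; split => w wB.
    move=> j; have := wB (enum_val j).1; rewrite inE => /(_ isT (enum_val j).2).
    by rewrite -surjective_pairing enum_valK.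
  by move=> i _ c; have := wB (enum_rank (i, c)); rewrite enum_rankK.
move=> ->.
rewrite (eq_bigl xpredT) => [|i]; last by rewrite inE.
rewrite (eq_bigr (fun i => \prod_(c < d) D (B (enum_rank (i, c))))%E); last first.
  by move=> i _; exact: (powX i (fun c => B (enum_rank (i, c)))).
rewrite pair_big /= (reindex (fun j : 'I_#|{: 'I_N * 'I_d}| => enum_val j)) /=; last first.
  by exists enum_rank => j _; rewrite ?enum_valK ?enum_rankK.
by apply: eq_bigr => j _; rewrite -surjective_pairing enum_valK.
Qed.

Theorem theorem2p2 (R : realType) (l : nat) :
  exists C : R, 0 < C /\
    forall (d r N : nat), (0 < d)%N -> C * d%:R * r%:R <= N%:R ->
    forall D : probability (measurableTypeR R) R, log_concave D ->
    forall (dO : measure_display) (Omega : measurableType dO)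
      (P : probability Omega R)
      (X : 'I_N -> {RV P >-> d.-tuple (measurableTypeR R)}),
      mutually_independent X ->
      (forall i, is_power_measure D (distribution P (X i))) ->
      let E := [set w : Omega |
        forall fstar : d.-tuple R -> R, network l r fstar ->
          [set f | network l r f /\ forall i, f (X i w) = fstar (X i w)]
          = [set fstar]] in
      measurable E /\ P E = 1%E.
Proof.
(* For [d, r > 0], [2 r (d + 1) + d <= 5 d r < 6 d r <= N], the strict bound required for width
   [2 r]. *)
exists 6; split=> // d r N d0 CN D [f [/density_atomless D0 _]] dO Omega P X indX powX E.
pose V := [set w | exists2 h : d.-tuple R -> R, network l (r + r) h &
    (forall i, h (X i w) = 0) /\ exists y, h y != 0].
have EV : E = ~` V by apply/seteqP; split => w /unique_interpolation.
have mV : measurable V by apply: measurable_vanishing_network => i; exact: measurable_funPT.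
rewrite EV; split; first exact: measurableC.
suff /negligibleP V0 : P.-negligible V by rewrite probability_setC// V0// sube0.
(* In width 0 the only network is zero, so [V] is empty. *)
case: r => [|r] in CN E V EV mV *.
  apply: negligibleS (negligible_set0 P) => w [h [a [W hE]] [_ [y]]].
  by rewrite hE big_ord0 eqxx.
pose u (j : 'I_#|{: 'I_N * 'I_d}|) w : measurableTypeR R := tnth (X (enum_val j).1 w) (enum_val j).2.
have mu j : measurable_fun setT (u j).
  exact: (measurableT_comp (measurable_tnth (enum_val j).2) (measurable_funPT (X (enum_val j).1))).
apply: negligibleS (iid_not_algdep D0 mu (coordinates_iid indX powX)).
move=> w [h hn [hX [y hy]]].
have rN : ((r.+1 + r.+1) * d.+1 + d < N)%N.
  move: CN; rewrite -!natrM ler_nat; nia.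
exact: (network_zeros_algdep d0 rN hn hX hy).
Qed.
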